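(* Let $p$ and $q$ be two distinct prime numbers, and let $\mathbb{Z}_{(p)}$ and $\mathbb{Z}_{(q)}$ be the localizations of $\mathbb{Z}$ at $p$ and $q$ respectively. Consider the ring $R = \begin{pmatrix} \mathbb{Z}_{(p)} & \mathbb{Q} \\ 0 & \mathbb{Z}_{(q)} \end{pmatrix}$ (with the usual matrix operations), its right ideal $L = \begin{pmatrix} 0 & \mathbb{Z}_{(q)} \\ 0 & \mathbb{Z}_{(q)} \end{pmatrix}$, and the right $R$-module $U = R/L$. Then the right $R$-module $U^2 = U \oplus U$ is lifting and does not satisfy the finite internal exchange property. In particular, lifting modules do not necessarily satisfy the finite internal exchange property.
   Context: All modules are unitary right modules. $\mathbb{Z}_{(p)}$ denotes the subring of $\mathbb{Q}$ of fractions with denominator not divisible by $p$. A submodule $N$ of a module $M$ is small in $M$ if $N + X \neq M$ for every proper submodule $X$ of $M$. A module $M$ is lifting if for any submodule $N$ of $M$ there exists a direct summand $X$ of $M$ with $X \subseteq N$ such that $N/X$ is small in $M/X$. A module $M$ satisfies the finite internal exchange property if, for any direct summand $X$ of $M$ and any finite direct sum decomposition $M = \bigoplus_{i=1}^n M_i$, there exist submodules $M_i' \subseteq M_i$ $(i = 1, \ldots, n)$ such that $M = X \oplus \left(\bigoplus_{i=1}^n M_i'\right)$. *)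

(* Defs.v *)
From HB Require Import structures.
From mathcomp Require Import all_boot all_order all_algebra.
From mathcomp Require Import boolp classical_sets.

Set Implicit Arguments.
Unset Strict Implicit.
Unset Printing Implicit Defensive.

Import Order.TTheory GRing.Theory Num.Theory.
Local Open Scope quotient_scope.
Local Open Scope classical_set_scope.
Local Open Scope ring_scope.

(* A right S-module is an [lmodType] over the converse ring [S^c]: there
   [a *: x] is "x acted on by a from the right", and the product of [a] and
   [b] in [S^c] is [b * a] in [S].  The definitions below are stated for an
   [lmodType] over any ring, to be used with rings of the form [S^c]. *)

Section Submodules.
Variables (R : pzRingType) (M : lmodType R).

Record submodule := Submodule {
  smcarrier :> set M;
  submodule_closed : submod_closed [in smcarrier]
}.

Definition submod_pred (X : submodule) : {pred M} := [in smcarrier X].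

HB.instance Definition _ (X : submodule) :=
  GRing.isSubmodClosed.Build R M (submod_pred X)
    (submodule_closed X).

Lemma submod_predP (X : submodule) x : reflect (smcarrier X x) (x \in submod_pred X).
Proof. exact: asboolP. Qed.

End Submodules.

Section QuotientModule.
Variables (R : pzRingType) (M : lmodType R) (X : submodule M).

Definition quotMod := Quotient.quot (submod_pred X).

HB.instance Definition _ := GRing.Zmodule.on quotMod.
HB.instance Definition _ :=
  ZmodQuotient.on quotMod.

Definition quotMod_scale (a : R) (u : quotMod) : quotMod :=
  \pi_quotMod (a *: repr u).

Lemma quotMod_eqP (x y : M) :
  reflect (\pi_quotMod x = \pi_quotMod y) (x - y \in submod_pred X).
Proof. by rewrite Quotient.idealrBE; apply: eqP. Qed.

Lemma quotMod_scale_pi a x :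
  quotMod_scale a (\pi_quotMod x) = \pi_quotMod (a *: x).
Proof.
apply/quotMod_eqP; rewrite -scalerBr rpredZ //.
by apply/quotMod_eqP; rewrite reprK.
Qed.

Lemma quotMod_piD (x y : M) :
  \pi_quotMod (x + y) = \pi_quotMod x + \pi_quotMod y.
Proof. exact: raddfD. Qed.

Fact quotMod_scaleA (a b : R) (u : quotMod) :
  quotMod_scale a (quotMod_scale b u) = quotMod_scale (a * b) u.
Proof. by elim/quotW: u => x; rewrite (quotMod_scale_pi b) !quotMod_scale_pi scalerA. Qed.

Fact quotMod_scale1 : left_id 1 quotMod_scale.
Proof. by elim/quotW=> x; rewrite quotMod_scale_pi scale1r. Qed.

Fact quotMod_scaleDr : right_distributive quotMod_scale +%R.
Proof.
move=> a; elim/quotW=> x; elim/quotW=> y; rewrite -quotMod_piD.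
by rewrite !quotMod_scale_pi scalerDr quotMod_piD.
Qed.

Fact quotMod_scaleDl (u : quotMod) : {morph quotMod_scale^~ u : a b / a + b}.
Proof.
elim/quotW: u => x a b; rewrite !quotMod_scale_pi.
by rewrite scalerDl quotMod_piD.
Qed.

HB.instance Definition _ := GRing.Zmodule_isLmodule.Build R quotMod
  quotMod_scaleA quotMod_scale1 quotMod_scaleDr quotMod_scaleDl.

Lemma quotMod_piZ a x : \pi_quotMod (a *: x) = a *: \pi_quotMod x.
Proof. by rewrite -quotMod_scale_pi. Qed.

Fact quotSub_closed (N : submodule M) :
  submod_closed [in [set \pi_quotMod x | x in N]].
Proof.
have [N0 Nlin] := submodule_closed N; split.
  by apply/mem_set; exists 0; [exact/set_mem | exact: raddf0].
move=> a _ _ /set_mem[x Nx <-] /set_mem[y Ny <-]; apply/mem_set.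
exists (a *: x + y); first by apply/set_mem/Nlin; apply/mem_set.
by rewrite quotMod_piD quotMod_piZ.
Qed.

(* The image of N in M/X; it is N/X when N contains X. *)
Definition quotSub (N : submodule M) : submodule quotMod :=
  Submodule (quotSub_closed N).

End QuotientModule.

Definition small (R : pzRingType) (M : lmodType R) (N : submodule M) : Prop :=
  forall X : submodule M, (X : set M) <> setT ->
    [set n + x | n in N & x in X] <> setT.

Section ModuleProperties.
Variables (R : pzRingType) (M : lmodType R).

(* M is the internal direct sum of the finite family F. *)
Definition direct_decomposition (I : finType) (F : I -> submodule M) : Prop :=
  forall m : M, exists! v : {ffun I -> M},
    (forall i, smcarrier (F i) (v i)) /\ m = \sum_i v i.

Definition direct_summand (X : submodule M) : Prop :=
  exists Y : submodule M,
    direct_decomposition (fun b : bool => if b then X else Y).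

Definition lifting : Prop :=
  forall N : submodule M, exists X : submodule M,
    [/\ direct_summand X, X `<=` N & small (quotSub X N)].

(* The family indexed by [option 'I_n] consists of X (at [None]) and of the
   M' i (at [Some i]). *)
Definition finite_internal_exchange : Prop :=
  forall (X : submodule M) (n : nat) (F : 'I_n -> submodule M),
    direct_summand X -> direct_decomposition F ->
    exists M' : 'I_n -> submodule M,
      (forall i, M' i `<=` F i) /\
      direct_decomposition (oapp M' X).

End ModuleProperties.

Arguments lifting {R} M.
Arguments finite_internal_exchange {R} M.

Definition Zloc (p : nat) : {pred rat} := fun x => ~~ (p %| denq x)%Z.

Lemma Zloc_frac (p : nat) (a d : int) :
  ~~ (p %| d)%Z -> a%:~R / d%:~R \in Zloc p.
Proof.
move=> pd; apply: contra (pd) => pden.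
have d0 : d%:~R != 0 :> rat.
  by rewrite intr_eq0; apply: contraNneq pd => ->; exact: dvdz0.
apply: dvdz_trans pden _; set x := a%:~R / _.
have : numq x * d = a * denq x.
  apply: (@intr_inj rat); rewrite !rmorphM /= numqE mulrAC.
  by rewrite /x divfK.
move=> e; rewrite -(@Gauss_dvdzr _ (numq x)); last first.
  by rewrite coprimez_sym; exact: coprime_num_den.
by rewrite e dvdz_mull.
Qed.

Lemma Zloc_subring p : prime p -> subring_closed (Zloc p).
Proof.
move=> p_prime.
have np1 : ~~ (p %| 1%Z)%Z 
  by rewrite dvdzE dvdn1 neq_ltn prime_gt1 ?orbT.
have npM (x y : rat) : x \in Zloc p -> y \in Zloc p ->
    ~~ (p %| denq x * denq y)%Z.
  by move=> xp yp; rewrite dvdzE abszM Euclid_dvdM // negb_or; apply/andP.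
split=> [|x y xp yp|x y xp yp]; first by have := Zloc_frac 1 np1; rewrite divr1.
  have := Zloc_frac (numq x * denq y - numq y * denq x) (npM _ _ xp yp).
  rewrite rmorphB !rmorphM /= -mulNr -addf_div ?intr_eq0 ?denq_neq0 //.
  by rewrite mulNr !divq_num_den.
have := Zloc_frac (numq x * numq y) (npM _ _ xp yp).
by rewrite !rmorphM /= -mulf_div !divq_num_den.
Qed.

(* The primality proofs are arguments because [Zloc p] is in general not
   closed under multiplication when p is composite. *)
Definition tri_pred p q (p_prime : prime p) (q_prime : prime q) :
    {pred 'M[rat]_2} :=
  [pred A : 'M[rat]_2 | [&& A 0 0 \in Zloc p, A 1 0 == 0 & A 1 1 \in Zloc q]].

Section TriangularRing.
Variables (p q : nat) (p_prime : prime p) (q_prime : prime q).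

Fact tri_subring : subring_closed (tri_pred p_prime q_prime).
Proof.
have [p1 pB pM] := Zloc_subring p_prime.
have [q1 qB qM] := Zloc_subring q_prime.
split=> [|A B|A B]; rewrite ?inE.
- by rewrite !mxE /= p1 q1.
- move=> /and3P[A0 /eqP A1 A2] /and3P[B0 /eqP B1 B2].
  by rewrite !mxE A1 B1 subrr eqxx pB // qB.
move=> /and3P[A0 /eqP A1 A2] /and3P[B0 /eqP B1 B2].
rewrite !mxE !big_ord_recl !big_ord0 /=.
have -> : lift ord0 ord0 = 1 :> 'I_2 by apply/val_inj.
rewrite A1 B1 !mulr0 !mul0r !addr0 !add0r.
by apply/and3P; split; [exact: pM | exact: eqxx | exact: qM].
Qed.

HB.instance Definition _ :=
  GRing.isSubringClosed.Build _ (tri_pred p_prime q_prime) tri_subring.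

Record triRing := TriRing {
  trimx :> 'M[rat]_2;
  _ : trimx \in tri_pred p_prime q_prime
}.

HB.instance Definition _ := [isSub for trimx].
HB.instance Definition _ := [Choice of triRing by <:].
HB.instance Definition _ := [SubChoice_isSubNzRing of triRing by <:].

(* The right regular module of [triRing]: [a *: x] is [x * a] in [triRing]. *)
Definition triMod : lmodType triRing^c := (triRing^c)^o.

Definition triL_set : set triMod :=
  [set A : triRing | [/\ A 0 0 = 0, A 0 1 \in Zloc q & A 1 1 \in Zloc q]].

Fact triL_closed : submod_closed [in triL_set].
Proof.
have [q1 qB qM] := Zloc_subring q_prime.
have q0 : 0 \in Zloc q by rewrite -(subrr 1) qB.
have qD x y : x \in Zloc q -> y \in Zloc q -> x + y \in Zloc q.
  by move=> xq yq; rewrite -[y]opprK qB // -sub0r qB.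
split; first by apply/mem_set; split; rewrite !mxE.
move=> a x y /set_mem[x0 x1 x2] /set_mem[y0 y1 y2]; apply/mem_set.
have /and3P[a0 /eqP a1 a2] := valP (a : triRing).
have /and3P[_ /eqP x3 _] := valP (x : triRing).
have e1 : lift ord0 ord0 = 1 :> 'I_2 by apply/val_inj.
have e0 : ord0 = 0 :> 'I_2 by [].
split; rewrite !mxE !big_ord_recl !big_ord0 /= e1 e0 addr0.
- by rewrite x0 y0 a1 mul0r mulr0 !addr0.
- by rewrite x0 mul0r add0r qD // qM.
- by rewrite x3 mul0r add0r qD // qM.
Qed.

Definition triL : submodule triMod := Submodule triL_closed.

Definition triU : lmodType triRing^c := quotMod triL.

End TriangularRing.

(* Main.v *)
Require Import Defs.
From HB Require Import structures.
From mathcomp Require Import all_boot all_order all_algebra.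
From mathcomp Require Import boolp classical_sets.

(* Integers with c1 a1 + c2 a2 = 1 split the "line" {(a1 u, a2 u)} off U^2.
   U is local: it is generated by the class of 1, and an element with diagonal
   coordinate outside p Z_(p) generates U.
   Lifting: a submodule N outside the radical of U^2 contains some (u, v) with
   u or v a generator; clearing denominators by a unit of Z_(p) turns it into a
   line X contained in N, and U^2/X is isomorphic to the local module U, in
   which proper submodules are small.
   Failure of exchange: write 1 = m p + n q and take the line X with slopes
   (m p, n q).  Every nonzero submodule of U contains the class s of (0, 1/q),
   which is killed by q, so (s, 0) lies in X.  Hence in a decomposition of
   U^2 as X + M1 + M2 with M1 in U + 0 and M2 in 0 + U, the summand M1 is 0, and
   projecting to the first coordinate makes multiplication by m p onto U, which
   is absurd. *)

Set Implicit Arguments.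
Unset Strict Implicit.
Unset Printing Implicit Defensive.

Import Order.TTheory GRing.Theory Num.Theory.
Local Open Scope quotient_scope.
Local Open Scope classical_set_scope.
Local Open Scope ring_scope.

(** * Submodules, direct summands and decompositions *)

Section SubmoduleTheory.
Variables (R : pzRingType) (M : lmodType R).
Implicit Types (X Y Z N : submodule M).

Lemma submodule0 X : smcarrier X 0.
Proof. by apply/submod_predP/rpred0. Qed.

Lemma submoduleZ X a x : smcarrier X x -> smcarrier X (a *: x).
Proof. by move=> /submod_predP Xx; apply/submod_predP/rpredZ. Qed.

Lemma submoduleD X x y :
  smcarrier X x -> smcarrier X y -> smcarrier X (x + y).
Proof. by move=> /submod_predP ? /submod_predP ?; apply/submod_predP/rpredD. Qed.

Lemma submoduleB X x y :
  smcarrier X x -> smcarrier X y -> smcarrier X (x - y).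
Proof. by move=> /submod_predP ? /submod_predP ?; apply/submod_predP/rpredB. Qed.

Lemma submod_closed_set (P : set M) :
  P 0 -> (forall a x y, P x -> P y -> P (a *: x + y)) -> submod_closed [in P].
Proof.
move=> P0 PD; split=> [|a x y /set_mem Px /set_mem Py]; apply/mem_set => //.
exact: PD.
Qed.

Fact zero_submod_closed : submod_closed [in [set 0 : M]].
Proof. by apply: submod_closed_set => // a x y -> ->; rewrite scaler0 addr0. Qed.
Definition zero_submodule : submodule M := Submodule zero_submod_closed.

Fact full_submod_closed : submod_closed [in [set: M]].
Proof. exact: submod_closed_set. Qed.
Definition full_submodule : submodule M := Submodule full_submod_closed.

Lemma direct_decomposition2P (F : bool -> submodule M) :
  (forall m, exists x y, [/\ smcarrier (F true) x, smcarrier (F false) y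
                           & m = x + y]) ->
  (forall m, smcarrier (F true) m -> smcarrier (F false) m -> m = 0) ->
  direct_decomposition F.
Proof.
move=> span indep m; have [x [y [Fx Fy ->]]] := span m.
exists [ffun b => if b then x else y]; split.
  by split=> [[]|]; rewrite ?ffunE // big_bool !ffunE.
move=> v [Fv]; rewrite big_bool /= => e.
have ev : v true - x = y - v false.
  by apply/eqP; rewrite subr_eq addrAC (addrC y) e addrK.
have /eqP : v true - x = 0.
  apply: indep; first exact: submoduleB (Fv true) Fx.
  by rewrite ev; apply: submoduleB Fy (Fv false).
rewrite subr_eq0 => /eqP vt; move: ev; rewrite vt subrr => /esym/eqP.
by rewrite subr_eq0 => /eqP vf; apply/ffunP => -[]; rewrite ffunE ?vt.
Qed.

Lemma direct_summandP X Y :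
  (forall m, exists x y, [/\ smcarrier X x, smcarrier Y y & m = x + y]) ->
  (forall m, smcarrier X m -> smcarrier Y m -> m = 0) ->
  direct_summand X.
Proof. by move=> ? ?; exists Y; apply: direct_decomposition2P. Qed.

Lemma direct_summand_zero : direct_summand zero_submodule.
Proof.
apply: (@direct_summandP _ full_submodule) => [m|m //].
by exists 0, m; rewrite add0r.
Qed.

Lemma direct_summand_full : direct_summand full_submodule.
Proof.
apply: (@direct_summandP _ zero_submodule) => [m|m //].
by exists m, 0; rewrite addr0.
Qed.

(** Placing [m] in slot [i] alone or in slot [j] alone gives two decompositions of [m]; uniqueness
    identifies them. *)
Lemma direct_decomposition_disjoint (I : finType) (F : I -> submodule M)
    (i j : I) (m : M) :
  direct_decomposition F -> i != j ->
  smcarrier (F i) m -> smcarrier (F j) m -> m = 0.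
Proof.
move=> dF ij Fi Fj; have [v [_ uv]] := dF m.
pose w k := [ffun l => if l == k then m else 0] : {ffun I -> M}.
have wP k : smcarrier (F k) m ->
    (forall l, smcarrier (F l) (w k l)) /\ m = \sum_l w k l.
  move=> Fk; split=> [l|].
    by rewrite ffunE; case: eqP => [-> //|_]; exact: submodule0.
  rewrite (bigD1 k) //= big1 ?addr0 ?ffunE ?eqxx // => l /negPf lk.
  by rewrite ffunE lk.
have /ffunP/(_ i) : w i = w j by rewrite -(uv _ (wP i Fi)) (uv _ (wP j Fj)).
by rewrite !ffunE eqxx (negPf ij).
Qed.

End SubmoduleTheory.

(* Smallness of N/X in M/X, read off in M. *)
Lemma small_quotSub (R : pzRingType) (M : lmodType R) (X N : submodule M) :
  (forall Z : submodule M, X `<=` Z -> (forall m, exists n z,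
      [/\ smcarrier N n, smcarrier Z z & m = n + z]) ->
    forall m, smcarrier Z m) ->
  small (quotSub X N).
Proof.
move=> h Z Znt NZ; apply: Znt.
have pi0 : \pi_(quotMod X) 0 = 0 by exact: raddf0.
pose Z' : set M := [set m | smcarrier Z (\pi_(quotMod X) m)].
have Z'c : submod_closed [in Z'].
  apply: submod_closed_set => [|a x y Zx Zy].
    by rewrite /Z' /= pi0; exact: submodule0.
  rewrite /Z' /= quotMod_piD quotMod_piZ.
  by apply: submoduleD => //; exact: submoduleZ.
rewrite predeqE => u; split=> // _; elim/quotW: u => m.
apply: (h (Submodule Z'c)) => [x Xx|{}m].
  rewrite /= /Z' /=.
  have -> : \pi_(quotMod X) x = 0.
    by rewrite -pi0; apply/quotMod_eqP; rewrite subr0; apply/submod_predP.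
  exact: submodule0.
have : [set: quotMod X] (\pi_(quotMod X) m) by [].
rewrite -NZ => -[_ [n Nn <-]] [z Zz e].
exists n, (m - n); split=> //; last by rewrite addrC subrK.
rewrite /= /Z' /=; suff -> : \pi_(quotMod X) (m - n) = z by [].
by apply: (addrI (\pi_(quotMod X) n)); rewrite -quotMod_piD addrC subrK e.
Qed.

(** * Lines with integer slopes in the square of a module *)

Section SquareModule.
Variables (R : pzRingType) (U : lmodType R).

(** Slopes are integers because these commute with the action of every scalar, which makes the set a
    submodule over a noncommutative ring. *)
Definition line_set (a1 a2 : int) : set (U * U)%type :=
  [set m | exists u : U, m = (u *~ a1, u *~ a2)].

Fact line_closed a1 a2 : submod_closed [in line_set a1 a2].
Proof.
apply: submod_closed_set => [|a _ _ [u ->] [v ->]].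
  by exists 0; rewrite !mul0rz.
by exists (a *: u + v); rewrite !mulrzDl !scalerMzr.
Qed.

Definition line a1 a2 : submodule (U * U)%type := Submodule (line_closed a1 a2).

(** The determinant of [(a1, a2)] and [m]. For unimodular slopes it is onto with kernel the line, so
    it identifies the quotient by the line with [U]. *)
Definition cross (a1 a2 : int) (m : U * U) : U := m.2 *~ a1 - m.1 *~ a2.

Lemma crossD a1 a2 m n : cross a1 a2 (m + n) = cross a1 a2 m + cross a1 a2 n.
Proof. by rewrite /cross /= !mulrzDl opprD addrACA. Qed.

Lemma crossZ a1 a2 a m : cross a1 a2 (a *: m) = a *: cross a1 a2 m.
Proof. by rewrite /cross /= scalerBr !scalerMzr. Qed.

Section Unimodular.
Variables (a1 a2 c1 c2 : int).
Hypothesis ca1 : c1 * a1 + c2 * a2 = 1.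

(** The matrix with columns [(a1, a2)] and [(- c2, c1)] has determinant 1; [u] and [v] are the
    coordinates of [m] given by its inverse. *)
Lemma line_decomp (m : U * U) (u := m.1 *~ c1 + m.2 *~ c2)
    (v := cross a1 a2 m) :
  m = (u *~ a1, u *~ a2) + (v *~ - c2, v *~ c1).
Proof.
have e1 : c1 * a1 = 1 - c2 * a2 by rewrite -ca1 addrK.
case: m @u @v => x y /=; rewrite /cross /=; congr (_, _).
  rewrite !mulrzDl !mulNrz !mulrNz -!mulrzA opprK.
  by rewrite e1 mulrzBr mulr1z (mulrC a1 c2) (mulrC a2 c2) /= addrA addrK subrK.
rewrite /= !mulrzDl !mulNrz -!mulrzA (mulrC a1 c1) e1 mulrzBr mulr1z /=.
by rewrite (mulrC a2 c1) [RHS]addrC addrA !subrK.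
Qed.

Lemma line_cross0 (m : U * U) : cross a1 a2 m = 0 -> smcarrier (line a1 a2) m.
Proof.
move=> m0; exists (m.1 *~ c1 + m.2 *~ c2).
by rewrite {1}(line_decomp m) m0 !mul0rz addr0.
Qed.

Lemma direct_summand_line : direct_summand (line a1 a2).
Proof.
apply: (@direct_summandP _ _ _ (line (- c2) c1)) => [m|_ [u ->] [v e]].
  exists ((m.1 *~ c1 + m.2 *~ c2) *~ a1, (m.1 *~ c1 + m.2 *~ c2) *~ a2).
  exists (cross a1 a2 m *~ - c2, cross a1 a2 m *~ c1).
  by split; [eexists| eexists | exact: line_decomp].
have [e1 e2] : u *~ a1 = v *~ - c2 /\ u *~ a2 = v *~ c1 by case: e.
suff -> : u = 0 by rewrite !mul0rz.
rewrite -[u]mulr1z -ca1 mulrzDr ![_ * a1]mulrC ![_ * a2]mulrC !mulrzA e1 e2.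
by rewrite -!mulrzA mulNr mulrC mulrNz addrC subrr.
Qed.

End Unimodular.
End SquareModule.

(** * Arithmetic of localizations of the integers *)

Lemma intr_Zloc (n : int) (l : nat) : prime l -> n%:~R \in Zloc l.
Proof.
move=> l_prime; rewrite -[_%:~R]divr1 -[1]/(1%:~R) Zloc_frac //.
by rewrite dvdzE dvdn1 neq_ltn prime_gt1 ?orbT.
Qed.

Section Localization.
Variables (p : nat).
Hypothesis p_prime : prime p.

(** The p-adic valuation of [x] is at most -1, so that of [p * x] is at most 0. *)
Lemma Zloc_inv x : x \notin Zloc p -> (p%:R * x)^-1 \in Zloc p.
Proof.
rewrite negbK => /dvdzP[k dx].
have p0 : p%:R != 0 :> rat by rewrite pnatr_eq0 -lt0n prime_gt0.
have k0 : k%:~R != 0 :> rat.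
  by rewrite intr_eq0; apply: contra_eqN dx => /eqP->; rewrite mul0r denq_neq0.
have -> : (p%:R * x)^-1 = k%:~R / (numq x)%:~R.
  rewrite -[RHS]invf_div -{1}(divq_num_den x) dx intrM -pmulrn.
  by rewrite (mulrCA p%:R) (invfM k%:~R) (mulrCA p%:R) divff // mulr1.
apply: Zloc_frac; apply/negP => pn.
have : (p %| gcdz (numq x) (denq x))%Z by rewrite dvdz_gcd pn dx dvdz_mull.
rewrite /gcdz (eqP (coprime_num_den x)) dvdzE dvdn1 => /eqP /= p1.
by move: p_prime; rewrite p1.
Qed.

Lemma pinv_notin_Zloc : p%:R^-1 \notin Zloc p.
Proof.
have p0 : p%:R != 0 :> rat by rewrite pnatr_eq0 -lt0n prime_gt0.
rewrite negbK; apply/dvdzP; exists (numq p%:R^-1); apply: (@intr_inj rat).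
by rewrite intrM numqE -pmulrn mulrAC mulVf // mul1r.
Qed.

(* Clear denominators, then divide by the gcd, which is a unit of Zloc p. *)
Lemma Zloc_unimodular x1 x2 :
    x1 \in Zloc p -> x2 \in Zloc p ->
    (x1 / p%:R \notin Zloc p) || (x2 / p%:R \notin Zloc p) ->
  exists t (a1 a2 c1 c2 : int),
    [/\ t \in Zloc p, x1 * t = a1%:~R, x2 * t = a2%:~R
      & c1 * a1 + c2 * a2 = 1].
Proof.
move=> x1p x2p x12; set d := denq x1 * denq x2.
have pd : ~~ (p %| d)%Z by rewrite dvdzE abszM Euclid_dvdM // negb_or; apply/andP.
have d0 : d%:~R != 0 :> rat by rewrite intr_eq0 mulf_neq0 ?denq_neq0.
pose n1 := numq x1 * denq x2; pose n2 := numq x2 * denq x1.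
have e1 : x1 = n1%:~R / d%:~R.
  by rewrite /n1 /d !intrM -mulf_div divff ?intr_eq0 ?denq_neq0 // mulr1 divq_num_den.
have e2 : x2 = n2%:~R / d%:~R.
  rewrite /n2 /d (mulrC (denq x1)) !intrM -mulf_div divq_num_den.
  by rewrite divff ?intr_eq0 ?denq_neq0 // mulr1.
have p0 : p%:R != 0 :> rat by rewrite pnatr_eq0 -lt0n prime_gt0.
have pdiv n : (p %| n)%Z -> n%:~R / d%:~R / p%:R \in Zloc p.
  move=> /dvdzP[k ->].
  by rewrite intrM -pmulrn mulrAC mulrK ?unitfE //; exact: Zloc_frac.
(* If [p] divided both numerators, both [x1 / p] and [x2 / p] would be p-integral. *)
have pg : ~~ (p %| gcdz n1 n2)%Z.
  rewrite dvdz_gcd negb_and; case/orP: x12 => h; apply/orP; [left|right].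
    by apply: contra h => /pdiv; rewrite -e1.
  by apply: contra h => /pdiv; rewrite -e2.
have g0 : gcdz n1 n2 != 0 by apply: contraNneq pg => ->; exact: dvdz0.
have g0' : (gcdz n1 n2)%:~R != 0 :> rat by rewrite intr_eq0.
have [c1 [c2 cE]] := Bezoutz n1 n2.
have [/dvdzP[a1 a1E] /dvdzP[a2 a2E]] := (dvdz_gcdl n1 n2, dvdz_gcdr n1 n2).
exists (d%:~R / (gcdz n1 n2)%:~R), a1, a2, c1, c2.
split.
- exact: Zloc_frac.
- by rewrite e1 mulrA divfK // {1}a1E intrM mulfK.
- by rewrite e2 mulrA divfK // {1}a2E intrM mulfK.
by apply: (mulIf g0); rewrite mul1r mulrDl -!mulrA -a1E -a2E.
Qed.
End Localization.

Lemma morphMz (V W : zmodType) (f : V -> W) :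
  {morph f : x y / x + y} -> forall x (n : int), f (x *~ n) = f x *~ n.
Proof.
move=> fD x; have f0 : f 0 = 0 by apply: (addIr (f 0)); rewrite -fD !add0r.
have fN y : f (- y) = - f y by apply: (addIr (f y)); rewrite -fD !addNr.
have fMn m : f (x *+ m) = f x *+ m.
  by elim: m => [|m IHm]; rewrite ?mulr0n // !mulrS fD IHm.
by case=> m; rewrite ?NegzE ?mulrNz ?fN -!pmulrn fMn.
Qed.

(** * The module U over the triangular ring *)

Section TriangularModule.
Variables (p q : nat) (p_prime : prime p) (q_prime : prime q).
Local Notation T := (triRing p_prime q_prime).
Local Notation U := (triU p_prime q_prime).
Implicit Types (r s : T) (u v : U).

Lemma tri_exists (a b c : rat) :
  a \in Zloc p -> c \in Zloc q ->
  exists r : T, [/\ r 0 0 = a, r 0 1 = b & r 1 1 = c].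
Proof.
move=> ap cq.
pose A := \matrix_(i < 2, j < 2)
  (if i == 0 then (if j == 0 then a else b) else (if j == 0 then 0 else c)).
have AP : A \in tri_pred p_prime q_prime by rewrite inE !mxE /= ap cq.
by exists (TriRing AP); rewrite !mxE.
Qed.

Lemma tri_pP r : r 0 0 \in Zloc p.
Proof. by have /and3P[] := valP r. Qed.

Lemma tri_qP r : r 1 1 \in Zloc q.
Proof. by have /and3P[] := valP r. Qed.

Lemma tri_mul00 r s : (r * s : T) 0 0 = r 0 0 * s 0 0.
Proof.
have /and3P[_ /eqP s0 _] := valP s.
rewrite mxE big_ord_recl big_ord1.
have -> : lift ord0 ord0 = 1 :> 'I_2 by apply/val_inj.
by rewrite s0 mulr0 addr0.
Qed.

Lemma tri_mul01 r s : (r * s : T) 0 1 = r 0 0 * s 0 1 + r 0 1 * s 1 1.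
Proof.
rewrite mxE big_ord_recl big_ord1.
by have -> : lift ord0 ord0 = 1 :> 'I_2 by apply/val_inj.
Qed.

Lemma tri_100 : (1 : T) 0 0 = 1.
Proof. by rewrite mxE. Qed.

Lemma tri_101 : (1 : T) 0 1 = 0.
Proof. by rewrite mxE. Qed.

Definition triU_pi (r : T) : U := \pi_(quotMod (triL p_prime q_prime)) r.

Lemma triU_piP u : exists r, u = triU_pi r.
Proof. by elim/quotW: u => r; exists r. Qed.

(** The lower right entry is lost modulo [L], so a class amounts to an element of Z_(p) together
    with an element of Q/Z_(q). *)
Lemma triU_pi_eq r s :
  triU_pi r = triU_pi s <-> r 0 0 = s 0 0 /\ r 0 1 - s 0 1 \in Zloc q.
Proof.
have [q1 qB qM] := Zloc_subring q_prime.
split=> [/quotMod_eqP/submod_predP[]|[e0 e1]].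
  by rewrite !mxE => /eqP + ? _; rewrite subr_eq0 => /eqP.
apply/quotMod_eqP/submod_predP; split; rewrite !mxE //.
  by rewrite e0 subrr.
by apply: qB; exact: tri_qP.
Qed.

Lemma triU_piZ r s : (r : T^c) *: triU_pi s = triU_pi (s * r).
Proof. by rewrite /triU_pi -quotMod_piZ. Qed.

Lemma triU_piD r s : triU_pi (r + s) = triU_pi r + triU_pi s.
Proof. exact: quotMod_piD. Qed.

Lemma triU_piMz r (n : int) : triU_pi (r *~ n) = triU_pi r *~ n.
Proof. by apply: morphMz => x y; exact: triU_piD. Qed.

Lemma tri_Mz r (n : int) i j : (r *~ n) i j = r i j * n%:~R.
Proof.
by rewrite mulrzr (morphMz (f := fun r : T => r i j)) // => x y; rewrite mxE.
Qed.

Lemma triU_gen u : exists r : T^c, u = r *: triU_pi 1.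
Proof. by have [r ->] := triU_piP u; exists r; rewrite triU_piZ mul1r. Qed.

(** The choice of representative is harmless: elements of [L] have zero upper left entry. *)
Definition top u : rat := (repr u : T) 0 0.

Lemma top_pi r : top (triU_pi r) = r 0 0.
Proof.
have : triU_pi (repr (triU_pi r)) = triU_pi r by rewrite /triU_pi reprK.
by case/triU_pi_eq.
Qed.

Lemma topD u v : top (u + v) = top u + top v.
Proof.
have [[r ->] [s ->]] := (triU_piP u, triU_piP v).
by rewrite -triU_piD !top_pi mxE.
Qed.

Lemma topMz u (n : int) : top (u *~ n) = top u * n%:~R.
Proof. by have [r ->] := triU_piP u; rewrite -triU_piMz !top_pi tri_Mz. Qed.

Lemma top_Zloc u : top u \in Zloc p.
Proof. by have [r ->] := triU_piP u; rewrite top_pi; exact: tri_pP. Qed.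

(** The maximal ideal p Z_(p) of Z_(p). *)
Definition rad : {pred rat} := fun x => x / p%:R \in Zloc p.

Lemma radE x : (x \in rad) = (x / p%:R \in Zloc p).
Proof. by []. Qed.

Lemma radD x y : x \in rad -> y \in rad -> x + y \in rad.
Proof.
have [p1 pB pM] := Zloc_subring p_prime.
rewrite !radE mulrDl => xp yp.
by rewrite -[y / _]opprK; apply: (pB) => //; rewrite -sub0r; apply: (pB).
Qed.

Lemma radMz x (n : int) : x \in rad -> x * n%:~R \in rad.
Proof.
have [p1 pB pM] := Zloc_subring p_prime.
by rewrite !radE mulrAC => xp; apply: pM => //; exact: intr_Zloc.
Qed.

Lemma one_notin_rad : 1 \notin rad.
Proof. by rewrite !radE mul1r; exact: pinv_notin_Zloc. Qed.

(** The upper left entry of [s] is a unit of Z_(p). Right multiplication by the diagonal matrix of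
    its inverse and 0 turns it into 1 and clears the upper right entry. *)
Lemma generator_of_notin_rad u :
  top u \notin rad -> exists r : T^c, triU_pi 1 = r *: u.
Proof.
have [s ->] := triU_piP u; rewrite top_pi => s0.
have [q1 qB qM] := Zloc_subring q_prime.
have p0 : p%:R != 0 :> rat by rewrite pnatr_eq0 -lt0n prime_gt0.
have s00 : s 0 0 != 0.
  by apply: contraNneq s0 => ->; rewrite radE mul0r (intr_Zloc 0).
have := Zloc_inv p_prime s0; rewrite mulrC divfK // => sV.
have [r [r0 r1 r2]] := tri_exists 0 sV (intr_Zloc 0 q_prime).
exists r; rewrite triU_piZ; apply/triU_pi_eq.
rewrite tri_mul00 tri_mul01 r0 r1 r2 divff // tri_100 tri_101 !mulr0 addr0.
by split=> //; exact: (intr_Zloc 0).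
Qed.

(** * The square of U is lifting *)

Lemma line_sub (N : submodule (U * U)%type) (m : U * U) :
  smcarrier N m -> (top m.1 \notin rad) || (top m.2 \notin rad) ->
  exists a1 a2 c1 c2 : int, c1 * a1 + c2 * a2 = 1 /\ line U a1 a2 `<=` N.
Proof.
case: m => u v /= Nuv h.
have [t [a1 [a2 [c1 [c2 [tp e1 e2 ca]]]]]] :=
  Zloc_unimodular p_prime (top_Zloc u) (top_Zloc v) h.
exists a1, a2, c1, c2; split=> // _ [w ->].
have [r ->] := triU_gen w.
(* The diagonal matrix of [t] and 0 scales the diagonal coordinates to [a1] and [a2] and erases the
   Q/Z_(q) components. *)
have [s [s0 s1 s2]] := tri_exists 0 tp (intr_Zloc 0 q_prime).
have sE (x : U) (a : int) : top x * t = a%:~R ->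
    (s : T^c) *: x = triU_pi 1 *~ a.
  have [x' ->] := triU_piP x; rewrite top_pi triU_piZ -triU_piMz => xa.
  apply/triU_pi_eq; rewrite tri_mul00 tri_mul01 !tri_Mz s0 s1 s2 xa.
  by rewrite tri_100 tri_101 !mulr0 mul1r mul0r addr0 subr0; split=> //; exact: (intr_Zloc 0).
have -> : ((r *: triU_pi 1) *~ a1, (r *: triU_pi 1) *~ a2) =
    r *: ((s : T^c) *: (u, v)) :> U * U.
  by rewrite !scalerMzr -(sE _ _ e1) -(sE _ _ e2).
by do 2!apply: submoduleZ.
Qed.

(** The cross of [z] generates [U], so any [m] differs from a multiple of [z] by an element of the
    kernel of [cross], which is the line. *)
Lemma cross_full (a1 a2 c1 c2 : int) (Z : submodule (U * U)%type) z :
  c1 * a1 + c2 * a2 = 1 -> line U a1 a2 `<=` Z -> smcarrier Z z ->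
  top (cross a1 a2 z) \notin rad -> forall m, smcarrier Z m.
Proof.
move=> ca XZ Zz /generator_of_notin_rad[r e] m.
have [s ms] := triU_gen (cross a1 a2 m).
rewrite -(subrK (s *: (r *: z)) m); apply: submoduleD; last first.
  by do 2!apply: submoduleZ.
apply: XZ; apply: (line_cross0 ca).
rewrite -[_ - _]addrC -scaleN1r crossD !crossZ -e -ms scaleN1r addrC.
by rewrite subrr.
Qed.

(** Locality of [U]: some vector has the class of 1 as its cross, and a sum of two elements with top
    in [rad] again has top in [rad]. *)
Lemma cross_split (a1 a2 c1 c2 : int) (N Z : submodule (U * U)%type) :
  c1 * a1 + c2 * a2 = 1 ->
  (forall m, exists n z, [/\ smcarrier N n, smcarrier Z z & m = n + z]) ->
  (exists2 n, smcarrier N n & top (cross a1 a2 n) \notin rad) \/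
  (exists2 z, smcarrier Z z & top (cross a1 a2 z) \notin rad).
Proof.
move=> ca NZ; have [n [z [Nn Zz e]]] := NZ (triU_pi 1 *~ - c2, triU_pi 1 *~ c1).
have : top (cross a1 a2 (n + z)) = 1.
  rewrite -e /cross /= -!mulrzA mulNr mulrNz opprK -mulrzDr ca.
  by rewrite mulr1z top_pi tri_100.
rewrite crossD topD => e1.
case: (boolP (top (cross a1 a2 n) \in rad)) => hn; last by left; exists n.
case: (boolP (top (cross a1 a2 z) \in rad)) => hz; last by right; exists z.
by have := one_notin_rad; rewrite -e1 radD.
Qed.

Lemma triU_square_lifting : lifting (U * U)%type.
Proof.
move=> N.
have [NT|NnT] := pselect (forall m, smcarrier N m).
  exists (full_submodule _); split=> [|m _ //|].
    exact: direct_summand_full.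
  by apply: small_quotSub => Z XZ _ m; exact: XZ.
(* A submodule inside the radical is small, so the zero summand serves. *)
have [Nrad|] := pselect (forall m, smcarrier N m ->
    top m.1 \in rad /\ top m.2 \in rad).
  exists (zero_submodule _); split=> [|_ ->|].
  - exact: direct_summand_zero.
  - exact: submodule0.
  apply: small_quotSub => Z _ NZ.
  (* As [n] is radical, [z] is not; hence [Z] contains a line, and modulo that line [N] remains
     radical. *)
  have [n [z [Nn Zz e]]] := NZ (triU_pi 1, 0).
  have zrad : (top z.1 \notin rad) || (top z.2 \notin rad).
    apply/orP; left; apply/negP => zr.
    have : top (n + z).1 = 1 by rewrite -e /= top_pi tri_100.
    rewrite topD => e1; have := one_notin_rad.
    by rewrite -e1 radD // (Nrad _ Nn).1.
  have [a1 [a2 [c1 [c2 [ca XZ]]]]] := line_sub Zz zrad.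
  have [[n' Nn' n'r]|[z' Zz' z'r]] := cross_split ca NZ; last first.
    exact: cross_full ca XZ Zz' z'r.
  case/negP: n'r; have [r1 r2] := Nrad _ Nn'.
  by rewrite /cross -mulrNz topD !topMz radD ?radMz.
move=> /existsNP[m /not_implyP[Nm mrad]].
have mr : (top m.1 \notin rad) || (top m.2 \notin rad).
  by rewrite -negb_and; apply/negP => /andP.
have [a1 [a2 [c1 [c2 [ca XN]]]]] := line_sub Nm mr.
exists (line U a1 a2); split=> //; first exact: direct_summand_line ca.
apply: small_quotSub => Z XZ NZ.
have [[n Nn nr]|[z Zz zr]] := cross_split ca NZ.
  (* [N] contains the line too, so a generator among its crosses would make it the whole module. *)
  by case: NnT; exact: cross_full ca XN Nn nr.
exact: cross_full ca XZ Zz zr.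
Qed.

(** * Failure of the finite internal exchange property *)

Lemma triU_socle : exists2 s : U, s != 0 &
  s *~ q = 0 /\ forall u, u != 0 -> exists r : T^c, s = r *: u.
Proof.
have q0 : q%:R != 0 :> rat by rewrite pnatr_eq0 -lt0n prime_gt0.
have pi0 : triU_pi 0 = 0 by apply: (addIr (triU_pi 0)); rewrite -triU_piD !add0r.
have [s [s0 s1 s2]] :=
  tri_exists q%:R^-1 (intr_Zloc 0 p_prime) (intr_Zloc 0 q_prime).
exists (triU_pi s).
  apply/eqP; rewrite -pi0 => /triU_pi_eq[_].
  by rewrite !mxE s1 subr0 (negPf (pinv_notin_Zloc q_prime)).
split=> [|u].
  rewrite -triU_piMz -pi0; apply/triU_pi_eq.
  rewrite !tri_Mz s0 s1 !mxE mul0r -pmulrn mulVf // subr0; split=> //.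
  exact: (intr_Zloc 1).
have [x ->] := triU_piP u => xn0.
(* If the top vanishes, the upper right entry is outside Z_(q) and is rescaled to [1/q] by an
   element of Z_(q). Otherwise a matrix whose only nonzero entry is the upper right one carries the
   top to [1/q], any rational being allowed there. *)
have [x0|x0] := eqVneq (x 0 0) 0.
  have x1 : x 0 1 \notin Zloc q.
    apply: contra xn0 => x1; rewrite -pi0; apply/eqP/triU_pi_eq.
    by rewrite !mxE subr0.
  have x10 : x 0 1 != 0 by apply: contraNneq x1 => ->; exact: (intr_Zloc 0).
  have [r [r0 r1 r2]] :=
    tri_exists 0 (intr_Zloc 0 p_prime) (Zloc_inv q_prime x1).
  exists r; rewrite triU_piZ; apply/triU_pi_eq.
  rewrite tri_mul00 tri_mul01 s0 s1 r1 r2 x0 mul0r add0r; split=> //.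
  by rewrite invfM mulrCA divff // mulr1 subrr; exact: (intr_Zloc 0).
have [r [r0 r1 r2]] := tri_exists (q%:R * x 0 0)^-1
  (intr_Zloc 0 p_prime) (intr_Zloc 0 q_prime).
exists r; rewrite triU_piZ; apply/triU_pi_eq.
rewrite tri_mul00 tri_mul01 s0 s1 r0 r1 r2 !mulr0 addr0; split=> //.
by rewrite invfM mulrCA divff // mulr1 subrr; exact: (intr_Zloc 0).
Qed.

Lemma triU_square_no_exchange : p <> q -> ~ finite_internal_exchange (U * U)%type.
Proof.
move=> /eqP pq ex.
have [m [n mn]] := Bezoutz p q.
have {mn} : m * p + n * q = 1.
  rewrite mn /gcdz /=; have /eqP -> // : coprime p q.
  by rewrite prime_coprime // dvdn_prime2.
(* The slopes [m * p] and [n * q] are unimodular with both coefficients equal to 1. *)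
rewrite -[m * p]mul1r -[n * q]mul1r => mn.
pose X := line U (m * p) (n * q).
pose F (i : 'I_2) := if i == 0 then line U 1 0 else line U 0 1.
have dF : direct_decomposition F.
  move=> [u v]; exists [ffun i => if i == 0 then (u, 0) else (0, v)].
  split.
    split=> [i|]; last first.
      rewrite big_ord_recl big_ord1 !ffunE /=.
      by congr (_, _); rewrite /= ?addr0 ?add0r.
    rewrite ffunE /F; case: eqP => _; first by exists u; rewrite mulr1z mulr0z.
    by exists v; rewrite mulr1z mulr0z.
  move=> w [Fw]; rewrite big_ord_recl big_ord1 => e.
  have l1 : lift ord0 ord0 = 1 :> 'I_2 by apply/val_inj.
  have [x wx] := Fw 0; have [y wy] : line_set 0 1 (w 1) := Fw 1.
  move: e; rewrite l1 wx wy /= !mulr1z !mulr0z => -[-> ->].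
  apply/ffunP => i; rewrite ffunE; case: eqP => [->|i0].
    by rewrite wx mulr1z mulr0z /= addr0.
  have -> : i = 1.
    by apply/val_inj; move/eqP: i0; rewrite -val_eqE; case: i => [[|[|]]].
  by rewrite wy mulr1z mulr0z /= add0r.
have [M' [M'F dM']] := ex X 2 F (direct_summand_line U mn) dF.
have [s s0 [sq smin]] := triU_socle.
have M'0 w : smcarrier (M' 0) w -> w = 0.
  move=> M'w; have [u wu] : line_set 1 0 w := M'F 0 _ M'w.
  move: wu; rewrite mulr1z mulr0z => wu.
  have [u00|u0] := eqVneq u 0; first by rewrite wu u00.
  have [r sr] := smin u u0.
  have Ms : smcarrier (M' 0) (s, 0).
    have -> : (s, 0) = r *: w by rewrite wu sr; congr (_, _); rewrite /= scaler0.
    exact: submoduleZ.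
  have Xs : smcarrier X (s, 0).
    (* [s] is its own parameter on the line: [n * q] kills it, so [m * p = 1 - n * q] fixes it. *)
    exists s; have snq : s *~ (n * q) = 0 by rewrite mulrC mulrzA sq mul0rz.
    rewrite snq; congr (_, _).
    by rewrite -[LHS]mulr1z -mn !mul1r mulrzDr snq addr0.
  have := direct_decomposition_disjoint dM' (isT : None != Some 0) Xs Ms.
  by case=> /eqP; rewrite (negPf s0).
have [v [[Xv e] _]] := dM' (triU_pi 1, 0).
have /(congr1 fst) := e.
rewrite (bigD1 None) //= (bigD1 (Some 0)) //= (bigD1 (Some 1)) //= big1; last first.
  by move=> [[[|[|i]] ?]|].
rewrite (M'0 _ (Xv (Some 0))) add0r addr0.
have [x ->] : line_set (m * p) (n * q) (v None) := Xv None.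
have [y ->] : line_set 0 1 (v (Some 1)) := M'F 1 _ (Xv (Some 1)).
(* Only the line contributes to the first coordinate, so 1 is the top of a multiple of [m * p] and
   would lie in [rad]. *)
rewrite /= mulr0z addr0 => /(congr1 top); rewrite topMz top_pi tri_100 => e1.
have := one_notin_rad; rewrite e1 radE intrM -pmulrn mulrA mulfK; last first.
  by rewrite pnatr_eq0 -lt0n prime_gt0.
have [_ _ pM] := Zloc_subring p_prime.
by rewrite pM ?top_Zloc ?intr_Zloc.
Qed.

End TriangularModule.

Theorem mainTheorem3 (p q : nat) (p_prime : prime p) (q_prime : prime q)
    (pq : p <> q) :
  let U := triU p_prime q_prime in
  [/\ lifting (U * U)%type,
      ~ finite_internal_exchange (U * U)%type
    & ~ (forall (S : pzRingType) (M : lmodType S^c),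
           lifting M -> finite_internal_exchange M)].
Proof.
move=> U; have lift2 := @triU_square_lifting p q p_prime q_prime.
have nex := @triU_square_no_exchange p q p_prime q_prime pq.
by split=> // ex; apply: nex; apply: (ex _ _ lift2).
Qed.
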